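(* Let $a > b > 0$ be real numbers and let $A$ be a complex $n \times n$ matrix whose spectrum belongs to $$\mathcal{E}_i = \left\{\lambda \in \mathbb{C} : \frac{(\mathrm{Re}\,\lambda)^2}{a^2} + \frac{(\mathrm{Im}\,\lambda)^2}{b^2} < 1 \right\}.$$ Let $H = H^* > 0$ be a solution to $$H - \left(\frac{1}{2a^2}+\frac{1}{2b^2}\right) A^*HA - \left(\frac{1}{4a^2}-\frac{1}{4b^2}\right)\left(HA^2+(A^* )^2H\right) = I.$$ If $B$ is a complex $n \times n$ matrix such that $$\|B\| < \sqrt{\|A\|^2 + \frac{b^2}{\|H\|}} - \|A\|,$$ then for every complex $n\times n$ matrix $C$ the matrix equation $$X - \left(\frac{1}{2a^2} + \frac{1}{2b^2}\right) (A + B)^*X(A + B) - \left(\frac{1}{4a^2} - \frac{1}{4b^2}\right)\left(X(A + B)^2 + (A^* + B^* )^2X\right) = C$$ has a unique solution $X$ among complex $n \times n$ matrices.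
   Context: $M^*$ denotes the conjugate transpose of $M$, and $I$ is the $n\times n$ identity matrix. For a Hermitian matrix $M$, $M > 0$ means that $M$ is positive definite. $\|\cdot\|$ is the spectral norm of matrices, i.e. the operator norm induced by the Euclidean norm on $\mathbb{C}^n$. *)

(* Defs.v *)
From mathcomp Require Import all_boot all_order all_algebra.
From mathcomp Require Import complex.
From mathcomp Require Import boolp classical_sets reals.

Set Implicit Arguments.
Unset Strict Implicit.
Unset Printing Implicit Defensive.

Import Order.TTheory GRing.Theory Num.Theory.

Local Open Scope classical_set_scope.
Local Open Scope ring_scope.
Local Open Scope complex_scope.
Local Open Scope sesquilinear_scope.

(* The complex numbers are R[i] for an arbitrary realType R. *)

Definition ellipse_int (R : realType) (a b : R) : set R[i] :=
  [set l : R[i] |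
    complex.Re l ^+ 2 / a ^+ 2 + complex.Im l ^+ 2 / b ^+ 2 < 1].

Definition spectrum (R : realType) (n : nat) (A : 'M[R[i]]_n) : set R[i] :=
  [set l : R[i] | eigenvalue A l].

(* The order on R[i] is partial: 0 < z means that z is real and positive. *)
Definition posdefmx (R : realType) (n : nat) (M : 'M[R[i]]_n) : Prop :=
  M \is hermsymmx /\
  forall x : 'cV[R[i]]_n, x != 0 -> 0 < (x ^t* *m M *m x) 0 0.

Definition euclid_norm (R : realType) (n : nat) (x : 'cV[R[i]]_n) : R :=
  Num.sqrt (\sum_(i < n) Normc.normc (x i 0) ^+ 2).

(* Not the library's norm `|A| of a matrix, which is the entrywise maximum. *)
Definition spectral_norm (R : realType) (n : nat) (A : 'M[R[i]]_n) : R :=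
  sup [set euclid_norm (A *m x) | x in [set x : 'cV[R[i]]_n | euclid_norm x <= 1]].

(* Main.v *)
(* Write p = 1/(2a^2) + 1/(2b^2), q = 1/(4a^2) - 1/(4b^2), M' for
   the conjugate transpose of M, and
   L_M(X) = X - p M'XM - q (XM^2 + (M')^2X).
   If H > 0 and L_M(H) > 0, testing L_M(H) on an eigenvector of M shows that the
   spectrum of M lies in the ellipse, because p|z|^2 + q(z^2 + conj(z)^2) equals
   (Re z)^2/a^2 + (Im z)^2/b^2.
   In that case L_M is injective: its kernel is stable under the commuting maps
   X |-> XM and X |-> M'X, so a nonzero kernel contains a common eigenvector
   (XM = zX, M'X = wX), whence p wz + q(z^2 + w^2) = 1, which is impossible for
   z and conj(w) in the ellipse.
   Finally L_A(H) = I, and L_{A+B}(H) differs from it in norm by at most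
   (p + 2|q|) |H| (2|A||B| + |B|^2), where p + 2|q| = 1/b^2; the bound on |B| makes
   this less than 1, so L_{A+B}(H) > 0. *)

Require Import Defs.
From HB Require Import structures.
From mathcomp Require Import all_boot all_order all_algebra.
From mathcomp Require Import complex.
From mathcomp Require Import boolp classical_sets reals.
From mathcomp Require Import ring lra.

Set Implicit Arguments.
Unset Strict Implicit.
Unset Printing Implicit Defensive.

Import Order.TTheory GRing.Theory Num.Theory.

Local Open Scope classical_set_scope.
Local Open Scope ring_scope.
Local Open Scope complex_scope.
Local Open Scope sesquilinear_scope.

(** * Linear algebra: bijectivity and eigenvectors *)

Lemma linear_mx_bij (F : fieldType) m n (f : {linear 'M[F]_(m, n) -> 'M[F]_(m, n)}) :
  (forall X, f X = 0 -> X = 0) -> forall C, exists! X, f X = C.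
Proof.
move=> f_inj C.
(* A row of the kernel of [lin_mx f] is a flattened element of the kernel of [f], hence zero. *)
have fU : lin_mx f \in unitmx.
  rewrite -row_free_unit -kermx_eq0; apply/eqP/row_matrixP => i; rewrite row0.
  have : row i (kermx (lin_mx f)) *m lin_mx f = 0 by rewrite -row_mul mulmx_ker row0.
  rewrite -[X in X *m _]vec_mxK mul_vec_lin => /(congr1 vec_mx).
  rewrite mxvecK linear0 => /f_inj /(congr1 mxvec).
  by rewrite vec_mxK linear0.
have fE X : f X = vec_mx (mxvec X *m lin_mx f) by rewrite mul_vec_lin mxvecK.
exists (vec_mx (mxvec C *m invmx (lin_mx f))); split.
  by rewrite fE vec_mxK mulmxKV // mxvecK.
by move=> X <-; rewrite fE vec_mxK mulmxK // mxvecK.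
Qed.

(** By Cayley-Hamilton, the product of M - zI over the roots z of the characteristic polynomial
    kills X. Multiplying X by one factor at a time, the last nonzero product is the eigenvector, and
    [P] has followed it. *)
Lemma stable_eigenvector (F : closedFieldType) m n (M : 'M[F]_n)
    (P : 'M[F]_(m, n) -> Prop) :
    (forall X z, P X -> P (X *m (M - z%:M))) ->
  forall X, X != 0 -> P X ->
  exists Y z, [/\ Y != 0, P Y & Y *m M = z *: Y].
Proof.
case: n M P => [|n] M P Pstable X X0 PX.
  by case/eqP: X0; apply/matrixP => i [].
have [s ps] := closed_field_poly_normal (char_poly M).
have : X *m horner_mx M (char_poly M) = 0 by rewrite Cayley_Hamilton mulmx0.
rewrite ps (monicP (char_poly_monic M)) scale1r {ps}.
elim: s X X0 PX => [|z s IHs] X X0 PX.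
  by rewrite big_nil rmorph1 mulmx1 => X0'; rewrite X0' eqxx in X0.
rewrite big_cons rmorphM /= -mulmxE mulmxA.
rewrite rmorphB /= horner_mx_X horner_mx_C.
have [XMz _|XMz] := eqVneq (X *m (M - z%:M)) 0.
  exists X, z; split=> //; apply/eqP.
  by rewrite -subr_eq0 -mul_mx_scalar -mulmxBr XMz.
by apply: IHs => //; apply: Pstable.
Qed.

Lemma eigenvalue_tr (F : fieldType) n (M : 'M[F]_n) z :
  eigenvalue M^T z = eigenvalue M z.
Proof.
rewrite /eigenvalue /eigenspace -[z%:M]tr_scalar_mx -linearB /=.
by rewrite !kermx_eq0 !row_free_unit unitmx_tr tr_scalar_mx.
Qed.

(** [eigenvalue] is about row vectors, so a column eigenvector comes from the transpose. *)
Lemma eigenvalue_col (F : fieldType) n (M : 'M[F]_n) z :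
  eigenvalue M z -> exists2 x : 'cV_n, x != 0 & M *m x = z *: x.
Proof.
rewrite -eigenvalue_tr => /eigenvalueP [v vM v0].
by exists v^T; rewrite ?trmx_eq0 // -[M]trmxK -trmx_mul vM linearZ.
Qed.

Lemma eigenvalue_mx (F : fieldType) m n (M : 'M[F]_n) (Y : 'M_(m, n)) z :
  Y != 0 -> Y *m M = z *: Y -> eigenvalue M z.
Proof.
move=> /rowV0Pn [u /submxP [v uE] u0] YM.
by apply/eigenvalueP; exists u; rewrite // uE -mulmxA YM scalemxAr.
Qed.

(** * Algebra of the operator [qlyap] *)

Section QuadraticLyapunov.
Variables (F : fieldType) (n : nat) (p q : F).
Implicit Types (N M X D : 'M[F]_n) (z w : F).

(* [N] plays the role of the conjugate transpose of [M], but is kept independent of [M]. *)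
Definition qlyap N M X : 'M[F]_n :=
  X - p *: (N *m X *m M) - q *: (X *m M ^+ 2 + N ^+ 2 *m X).

Fact qlyap_is_linear N M : linear (qlyap N M).
Proof.
move=> k X Y; rewrite /qlyap !(mulmxDr, mulmxDl) -!(scalemxAl, scalemxAr).
move: (_ *m X *m _) (_ *m Y *m _) => T1 T2.
move: (X *m _) (Y *m _) (_ *m X) (_ *m Y) => T3 T4 T5 T6.
by apply/matrixP => i j; rewrite !mxE; ring.
Qed.

HB.instance Definition _ N M := GRing.isLinear.Build F 'M[F]_n 'M[F]_n _
  (qlyap N M) (qlyap_is_linear N M).

Lemma qlyap_mulr N M X D : M *m D = D *m M -> qlyap N M (X *m D) = qlyap N M X *m D.
Proof.
move=> c; rewrite /qlyap !expr2 -!mulmxE !mulmxBl -!scalemxAl mulmxDl.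
by rewrite -!mulmxA c (mulmxA D M M) -c -mulmxA c.
Qed.

Lemma qlyap_mull N M X D : N *m D = D *m N -> qlyap N M (D *m X) = D *m qlyap N M X.
Proof.
move=> c; rewrite /qlyap !expr2 -!mulmxE !mulmxBr -!scalemxAr mulmxDr.
by rewrite !mulmxA c -(mulmxA N N D) c mulmxA c.
Qed.

Lemma qlyap_eigen N M X z w : X *m M = z *: X -> N *m X = w *: X ->
  qlyap N M X = (1 - (p * (w * z) + q * (z ^+ 2 + w ^+ 2))) *: X.
Proof.
move=> XM NX; rewrite /qlyap !expr2 -!mulmxE mulmxA XM -scalemxAl XM.
rewrite -(mulmxA N N X) NX -scalemxAr NX -scalemxAl XM !scalerA -!scalerDl scalerA.
by rewrite -[X in X - _ - _]scale1r -!scalerBl; congr (_ *: X); ring.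
Qed.

Lemma qlyap_form N M X (y : 'rV_n) (x : 'cV_n) z w :
    M *m x = z *: x -> y *m N = w *: y ->
  y *m qlyap N M X *m x = (1 - (p * (w * z) + q * (z ^+ 2 + w ^+ 2))) *: (y *m X *m x).
Proof.
move=> Mx yN.
have e1 : y *m (N *m X *m M) *m x = (w * z) *: (y *m X *m x).
  by rewrite !mulmxA yN -!scalemxAl -(mulmxA _ M) Mx -scalemxAr scalerA.
have e2 : y *m (X *m (M *m M)) *m x = (z * z) *: (y *m X *m x).
  by rewrite -!mulmxA Mx -scalemxAr Mx -!scalemxAr !mulmxA scalerA.
have e3 : y *m (N *m N *m X) *m x = (w * w) *: (y *m X *m x).
  by rewrite !mulmxA yN -!scalemxAl yN -!scalemxAl scalerA.
rewrite !(mulmxBr, mulmxBl) -!(scalemxAr, scalemxAl) mulmxDr mulmxDl e1 e2 e3.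
move: (y *m X *m x) => T.
by apply/matrixP => i j; rewrite !mxE; ring.
Qed.

Lemma qlyapDmx N M (N' M' X : 'M[F]_n) : qlyap (N + N') (M + M') X = qlyap N M X
  - (p *: (N *m X *m M' + N' *m X *m M + N' *m X *m M')
     + q *: (X *m (M *m M') + X *m (M' *m M) + X *m (M' *m M')
             + N *m N' *m X + N' *m N *m X + N' *m N' *m X)).
Proof.
rewrite /qlyap !expr2 -!mulmxE !(mulmxDl, mulmxDr).
set T1 := N *m X *m M; set T2 := N *m X *m M'; set T3 := N' *m X *m M.
set T4 := N' *m X *m M'; set U1 := X *m (M *m M); set U2 := X *m (M *m M').
set U3 := X *m (M' *m M); set U4 := X *m (M' *m M').
set V1 := N *m N *m X; set V2 := N *m N' *m X.
set V3 := N' *m N *m X; set V4 := N' *m N' *m X.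
(* With the matrix products made opaque, the identity is linear in them and holds entrywise. *)
move: T1 T2 T3 T4 U1 U2 U3 U4 V1 V2 V3 V4 => T1 T2 T3 T4 U1 U2 U3 U4 V1 V2 V3 V4.
by apply/matrixP => i j; rewrite !mxE; ring.
Qed.

End QuadraticLyapunov.

Lemma qlyap_ker_eigen (F : closedFieldType) n (p q : F) (N M X : 'M[F]_n) :
  X != 0 -> qlyap p q N M X = 0 ->
  exists z w, [/\ eigenvalue M z, eigenvalue N w
    & p * (w * z) + q * (z ^+ 2 + w ^+ 2) = 1].
Proof.
move=> X0 LX.
have commD (D : 'M[F]_n) (t : F) : D *m (D - t%:M) = (D - t%:M) *m D.
  by rewrite mulmxBr mulmxBl scalar_mxC.
have [||Y [z [Y0 LY YM]]] :=
    @stable_eigenvector _ _ _ M (fun Y => qlyap p q N M Y = 0) _ X X0.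
- by move=> Y t LY; rewrite qlyap_mulr // LY mul0mx.
- by [].
(* N acts on the left, so the search runs on transposes. The property carries the eigenvector
   equation for M along, since left multiplication preserves it. *)
have [|||Z [w [Z0 [LZ ZM] ZN]]] := @stable_eigenvector _ _ _ N^T
    (fun Z => qlyap p q N M Z^T = 0 /\ Z^T *m M = z *: Z^T) _ Y^T _ _.
- move=> Z t [LZ ZM]; rewrite trmx_mul linearB /= trmxK tr_scalar_mx.
  by rewrite qlyap_mull // LZ mulmx0 -mulmxA ZM scalemxAr.
- by rewrite trmx_eq0.
- by rewrite trmxK.
have NZ : N *m Z^T = w *: Z^T by rewrite -[N]trmxK -trmx_mul ZN linearZ.
have ZT0 : Z^T != 0 by rewrite trmx_eq0.
exists z, w; split; first exact: eigenvalue_mx ZT0 ZM.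
  by rewrite -eigenvalue_tr; exact: eigenvalue_mx Z0 ZN.
move: LZ; rewrite (qlyap_eigen p q ZM NZ) => /eqP.
by rewrite scaler_eq0 (negPf ZT0) orbF subr_eq0 => /eqP <-.
Qed.

(** * The ellipse and its quadratic form *)

Section Ellipse.
Variables (R : realType) (a b : R).
Hypotheses (a0 : 0 < a) (b0 : 0 < b).
Implicit Types z w : R[i].

Let p : R := 1 / (2 * a ^+ 2) + 1 / (2 * b ^+ 2).
Let q : R := 1 / (4 * a ^+ 2) - 1 / (4 * b ^+ 2).

Lemma ellipse_form_conj z :
  p%:C * (z^* * z) + q%:C * (z ^+ 2 + z^* ^+ 2)
  = (complex.Re z ^+ 2 / a ^+ 2 + complex.Im z ^+ 2 / b ^+ 2)%:C.
Proof.
case: z => u v; rewrite /p /q !expr2; simpc; congr (_ +i* _) => /=; last first.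
  by ring.
by field; rewrite !gt_eqF.
Qed.

(** The real part of the form is at most the mean of the ellipse functions at z and [w^*], both
    below 1. *)
Lemma ellipse_form_neq1 z w : ellipse_int a b z -> ellipse_int a b w^* ->
  p%:C * (w * z) + q%:C * (z ^+ 2 + w ^+ 2) != 1.
Proof.
case: z w => [u v] [s t]; rewrite /ellipse_int /= sqrrN => zE wE.
apply/eqP => /(congr1 (@complex.Re R)); rewrite /p /q !expr2; simpc => /= E.
suff : 0 < 1 - 1 :> R by rewrite subrr ltxx.
(* With z = u + iv, w = s + it, this exhibits 1 minus the real part of the form
   as a positive term plus a sum of squares. *)
rewrite -[X in _ - X]E [X in 0 < X](_ : _ =
    ((1 - (u ^+ 2 / a ^+ 2 + v ^+ 2 / b ^+ 2))
      + (1 - (s ^+ 2 / a ^+ 2 + t ^+ 2 / b ^+ 2))) / 2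
    + (((u - s) / (2 * a)) ^+ 2 + ((u - s) / (2 * b)) ^+ 2
      + ((v + t) / (2 * b)) ^+ 2 + ((v + t) / (2 * a)) ^+ 2)).
apply: ltr_pwDl; first by apply: divr_gt0 => //; apply: addr_gt0; rewrite subr_gt0.
  by do ![apply: addr_ge0]; exact: sqr_ge0.
by field; rewrite !gt_eqF.
Qed.

End Ellipse.

(** * Spectrum in the ellipse: consequence and criterion *)

Lemma qlyap_ellipse_bij (R : realType) n (a b : R) (M C : 'M[R[i]]_n) :
    0 < a -> 0 < b -> spectrum M `<=` ellipse_int a b ->
  exists! X, qlyap (1 / (2 * a ^+ 2) + 1 / (2 * b ^+ 2))%:C
               (1 / (4 * a ^+ 2) - 1 / (4 * b ^+ 2))%:C (M ^t*) M X = C.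
Proof.
move=> a0 b0 Mab; apply: linear_mx_bij => X LX; apply/eqP/negPn/negP => X0.
have [z [w [Mz Mw zw1]]] := qlyap_ker_eigen X0 LX.
suff Mw' : eigenvalue M w^*.
  by have := ellipse_form_neq1 a0 b0 (Mab _ Mz) (Mab _ Mw'); rewrite zw1 eqxx.
(* The conjugate transpose of a column eigenvector of [M ^t*] for w is a row eigenvector of M for
   [w^*]. *)
have [x x0 xw] := eigenvalue_col Mw.
apply/eigenvalueP; exists (x ^t*); last by rewrite map_mx_eq0 trmx_eq0.
rewrite -[in LHS](trmxCK M) -map_mxM -trmx_mul xw linearZ /=.
by rewrite map_mxZ.
Qed.

(** The real part moves estimates from the partial order of [R[i]] to the total order of [R]. *)
Definition re_form (R : realType) n (x : 'cV[R[i]]_n) (K : 'M[R[i]]_n) : R :=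
  complex.Re ((x ^t* *m K *m x) 0 0).

Lemma qlyap_posdef_spectrum (R : realType) n (a b : R) (M H : 'M[R[i]]_n) :
    0 < a -> 0 < b -> posdefmx H ->
    (forall x, x != 0 ->
      0 < re_form x (qlyap (1 / (2 * a ^+ 2) + 1 / (2 * b ^+ 2))%:C
                       (1 / (4 * a ^+ 2) - 1 / (4 * b ^+ 2))%:C (M ^t*) M H)) ->
  spectrum M `<=` ellipse_int a b.
Proof.
move=> a0 b0 [_ Hpos] Lpos z /eigenvalue_col [x x0 Mx].
have xM : x ^t* *m M ^t* = z^* *: x ^t*.
  by rewrite -map_mxM -trmx_mul Mx linearZ /= map_mxZ.
have := Lpos x x0; have := Hpos x x0.
rewrite /re_form (qlyap_form _ _ _ Mx xM).
have := ellipse_form_conj a0 b0 z => /= ->.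
move: (x ^t* *m H *m x) => h; rewrite [X in complex.Re X]mxE => h0.
(* The value of the form of H is real, so the real scalar factor can be split off. *)
rewrite -(RRe_real (gtr0_real h0)) -[1](rmorph1 (real_complex R)) -rmorphB -rmorphM /=.
by rewrite pmulr_lgt0 ?subr_gt0 // -ltcR RRe_real // gtr0_real.
Qed.

(** * Euclidean and spectral norms *)

Section SpectralNorm.
Variable R : realType.

Lemma euclid_norm_ge0 n (x : 'cV[R[i]]_n) : 0 <= euclid_norm x.
Proof. exact: sqrtr_ge0. Qed.

Lemma sqr_euclid_norm n (x : 'cV[R[i]]_n) :
  (euclid_norm x ^+ 2)%:C = (x ^t* *m x) 0 0.
Proof.
rewrite sqr_sqrtr ?sumr_ge0 // => [|i _]; last exact: sqr_ge0.
rewrite mxE rmorph_sum /=; apply: eq_bigr => i _; rewrite !mxE mulrC.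
by rewrite -normCK rmorphXn /=; case: (x i 0).
Qed.

Lemma euclid_norm_gt0 n (x : 'cV[R[i]]_n) : x != 0 -> 0 < euclid_norm x.
Proof.
move=> x0; rewrite lt_neqAle euclid_norm_ge0 andbT eq_sym.
apply: contra_neq x0 => nx0; apply/matrixP => i j; rewrite ord1 mxE.
have := sqr_euclid_norm x; rewrite nx0 expr0n /= mxE => /esym/eqP.
rewrite psumr_eq0 => [/allP/(_ i)|k _]; rewrite !mxE mulrC.
  by rewrite mul_conjC_eq0 mem_index_enum => /(_ isT)/eqP.
exact: mul_conjC_ge0.
Qed.

Lemma normc_dot_le n (y x : 'cV[R[i]]_n) :
  `|(y ^t* *m x) 0 0| <= (euclid_norm y * euclid_norm x)%:C.
Proof.
(* [dotmx] pairs rows and conjugates its second argument, hence the transposes and the swap. *)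
have E (u v : 'cV[R[i]]_n) : (u ^t* *m v) 0 0 = dotmx v^T u^T.
  by rewrite dotmxE !mxE; apply: eq_bigr => i _; rewrite !mxE mulrC.
rewrite -(@ler_pXn2r _ 2) ?nnegrE ?normr_ge0 ?ler0c ?mulr_ge0 ?euclid_norm_ge0 //.
rewrite -[leRHS]rmorphXn /= exprMn rmorphM /= !sqr_euclid_norm !E [leRHS]mulrC.
exact: CauchySchwarz.
Qed.

Lemma euclid_normZ n (k : R) (x : 'cV[R[i]]_n) :
  0 <= k -> euclid_norm (k%:C *: x) = k * euclid_norm x.
Proof.
move=> k0; apply/eqP; rewrite -(@eqrXn2 _ 2) ?mulr_ge0 ?euclid_norm_ge0 //.
apply/eqP/(@complexI R); rewrite exprMn [in RHS]rmorphM /= !sqr_euclid_norm.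
rewrite [(_ *: x)^T]linearZ /= map_mxZ -scalemxAl -scalemxAr !mxE mulrA.
by congr (_ * _); rewrite /= expr2; simpc.
Qed.

(** This makes [sup] a genuine supremum. Cauchy-Schwarz on each row gives the Frobenius norm as
    bound. *)
Lemma spectral_norm_has_ubound n (A : 'M[R[i]]_n) :
  has_ubound [set euclid_norm (A *m x) | x in [set x : 'cV[R[i]]_n | euclid_norm x <= 1]].
Proof.
exists (Num.sqrt (\sum_i euclid_norm ((row i A) ^t*) ^+ 2)) => _ [x /= x1 <-].
rewrite ler_sqrt ?sumr_ge0 // => [|i _]; last exact: sqr_ge0.
apply: ler_sum => i _.
have : `|(A *m x) i 0| <= (euclid_norm ((row i A) ^t*))%:C.
  have := normc_dot_le ((row i A)^t*) x; rewrite trmxCK.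
  rewrite -row_mul mxE => /le_trans; apply; rewrite lecR.
  by rewrite ler_piMr ?euclid_norm_ge0.
case: (_ i 0) => u v; rewrite lecR => uv.
by rewrite ler_pXn2r // nnegrE ?euclid_norm_ge0 // sqrtr_ge0.
Qed.

Lemma spectral_norm_ge0 n (A : 'M[R[i]]_n) : 0 <= spectral_norm A.
Proof.
apply: le_trans (euclid_norm_ge0 (A *m 0)) _.
have := @ub_le_sup _ _ (spectral_norm_has_ubound A) (euclid_norm (A *m 0)); apply.
exists 0 => //=; rewrite /euclid_norm big1 ?sqrtr0 // => i _.
by rewrite mxE Normc.normc0 expr0n.
Qed.

(** A nonzero x is rescaled to norm 1; x = 0 is treated apart. *)
Lemma euclid_norm_mulmx n (A : 'M[R[i]]_n) x :
  euclid_norm (A *m x) <= spectral_norm A * euclid_norm x.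
Proof.
have [->|x0] := eqVneq x 0.
  rewrite mulmx0 -(scale0r 0) -[0 *: 0]/((0 : R)%:C *: 0) euclid_normZ //.
  by rewrite mul0r mulr0.
have nx0 := euclid_norm_gt0 x0.
rewrite -ler_pdivrMr // mulrC -euclid_normZ ?invr_ge0 ?euclid_norm_ge0 // scalemxAr.
rewrite /spectral_norm ub_le_sup //; first exact: spectral_norm_has_ubound.
by eexists => //=; rewrite euclid_normZ ?invr_ge0 ?euclid_norm_ge0 // mulVf ?gt_eqF.
Qed.

Lemma spectral_norm_dot n (H : 'M[R[i]]_n) (y z : 'cV[R[i]]_n) c d :
    euclid_norm y <= c -> euclid_norm z <= d ->
  `|complex.Re ((y ^t* *m (H *m z)) 0 0)| <= spectral_norm H * (c * d).
Proof.
move=> yc zd; rewrite -lecR; apply: le_trans (normc_ge_Re _) _.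
apply: le_trans (normc_dot_le _ _) _; rewrite lecR mulrCA.
apply: ler_pM; rewrite ?euclid_norm_ge0 //.
apply: le_trans (euclid_norm_mulmx _ _) _.
by apply: ler_wpM2l => //; exact: spectral_norm_ge0.
Qed.

End SpectralNorm.

(** * Perturbation estimate *)

Lemma sqr_lt_sqrtr (F : rcfType) (x y : F) :
  0 <= x -> x < Num.sqrt y -> x ^+ 2 < y.
Proof.
(* [Num.sqrt] is 0 on nonpositive numbers, so the strict bound forces y > 0. *)
move=> x0 xy; have y0 : 0 < y by rewrite -sqrtr_gt0 (le_lt_trans x0).
by rewrite -[ltRHS]sqr_sqrtr ?ltW // ltr_pXn2r // nnegrE sqrtr_ge0.
Qed.

(** Two groups of three terms carry the weight q, and |q| = -q, whence p - 2q. *)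
Lemma weighted_sum_le (F : realFieldType) (p q c1 c2 c3 r1 r2 r3 l1 l2 l3 s t u : F) :
    0 <= p -> q <= 0 ->
    `|c1| <= s -> `|c2| <= t -> `|c3| <= u ->
    `|r1| <= s -> `|r2| <= t -> `|r3| <= u ->
    `|l1| <= s -> `|l2| <= t -> `|l3| <= u ->
  p * (c1 + c2 + c3) + q * (r1 + r2 + r3 + l1 + l2 + l3)
    <= (p - 2 * q) * (s + t + u).
Proof.
move=> p0 q0; rewrite !ler_norml.
do 9 (move=> /andP[? ?]); rewrite mulrBl [2 * q]mulrC -mulrA -mulrN.
by apply: lerD; [apply: ler_wpM2l | apply: ler_wnM2l] => //; lra.
Qed.

Section Perturbation.
Variables (R : realType) (n : nat) (H A B : 'M[R[i]]_n) (x : 'cV[R[i]]_n).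

Local Notation phi := (re_form x).

Let re_formD K L : phi (K + L) = phi K + phi L.
Proof. by rewrite /re_form mulmxDr mulmxDl mxE raddfD. Qed.

Let re_formB K L : phi (K - L) = phi K - phi L.
Proof. by rewrite /re_form mulmxBr mulmxBl !mxE raddfB. Qed.

Let re_formZ (k : R) K : phi (k%:C *: K) = k * phi K.
Proof.
rewrite /re_form -scalemxAr -scalemxAl mxE.
by case: (_ 0 0) => u v /=; rewrite mul0r subr0.
Qed.

Let norm_mulmx_le2 (U V : 'M[R[i]]_n) : euclid_norm (U *m (V *m x))
  <= spectral_norm U * (spectral_norm V * euclid_norm x).
Proof.
apply: le_trans (euclid_norm_mulmx _ _) _; apply: ler_wpM2l.
  exact: spectral_norm_ge0.
exact: euclid_norm_mulmx.
Qed.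

(** A common bound for products of U and V with H in the middle, on the left or on the right. *)
Let bnd (U V : 'M[R[i]]_n) : R := spectral_norm H
  * (spectral_norm U * spectral_norm V * euclid_norm x ^+ 2).

Let re_form_mid U V : `|phi (U ^t* *m H *m V)| <= bnd U V.
Proof.
rewrite /re_form [X in fun_of_matrix X](_ : _ = (U *m x) ^t* *m (H *m (V *m x))).
  rewrite /bnd expr2 mulrACA.
  by apply: spectral_norm_dot; exact: euclid_norm_mulmx.
by rewrite trmx_mul map_mxM !mulmxA.
Qed.

Let re_form_right U V : `|phi (H *m (U *m V))| <= bnd U V.
Proof.
rewrite /re_form [X in fun_of_matrix X](_ : _ = x ^t* *m (H *m (U *m (V *m x)))).
  have -> : bnd U V = spectral_norm H * (euclid_norm x
      * (spectral_norm U * (spectral_norm V * euclid_norm x))).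
    rewrite /bnd; move: (spectral_norm H) (spectral_norm U) (spectral_norm V).
    by move: (euclid_norm x) => *; ring.
  exact: spectral_norm_dot.
by rewrite !mulmxA.
Qed.

Let re_form_left U V : `|phi (U ^t* *m V ^t* *m H)| <= bnd U V.
Proof.
rewrite /re_form [X in fun_of_matrix X](_ : _ = (V *m (U *m x)) ^t* *m (H *m x)).
  have -> : bnd U V = spectral_norm H
      * (spectral_norm V * (spectral_norm U * euclid_norm x) * euclid_norm x).
    rewrite /bnd; move: (spectral_norm H) (spectral_norm U) (spectral_norm V).
    by move: (euclid_norm x) => *; ring.
  exact: spectral_norm_dot.
by rewrite !trmx_mul !map_mxM !mulmxA.
Qed.

Lemma qlyap_perturb (p q : R) : 0 <= p -> q <= 0 ->
    phi (qlyap p%:C q%:C (A ^t*) A H)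
      - (p - 2 * q) * (spectral_norm H
          * (2 * spectral_norm A * spectral_norm B + spectral_norm B ^+ 2)
          * euclid_norm x ^+ 2)
  <= phi (qlyap p%:C q%:C ((A + B) ^t*) (A + B) H).
Proof.
move=> p0 q0.
have -> : (A + B) ^t* = A ^t* + B ^t* by rewrite linearD /= map_mxD.
rewrite qlyapDmx; move: (qlyap _ _ _ A H) => L0; rewrite re_formB lerD2l.
rewrite lerN2 re_formD !re_formZ !re_formD.
(* The three summands match the pairs (A,B), (B,A), (B,B) that index the terms of [qlyapDmx]. *)
rewrite [X in _ <= _ * X](_ : _ = bnd A B + bnd B A + bnd B B).
  exact: (weighted_sum_le p0 q0 (re_form_mid A B) (re_form_mid B A)
    (re_form_mid B B) (re_form_right A B) (re_form_right B A) (re_form_right B B)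
    (re_form_left A B) (re_form_left B A) (re_form_left B B)).
rewrite /bnd; move: (spectral_norm H) (spectral_norm A) (spectral_norm B).
by move: (euclid_norm x) => *; ring.
Qed.

End Perturbation.

(** * Unique solvability of the perturbed equation *)

Theorem corollary2 (R : realType) (n : nat) (a b : R)
    (hb : 0 < b) (hab : b < a)
    (A : 'M[R[i]]_n) (hA : spectrum A `<=` ellipse_int a b)
    (H : 'M[R[i]]_n) (hH : posdefmx H)
    (hHeq : H
      - (1 / (2 * a ^+ 2) + 1 / (2 * b ^+ 2))%:C *: (A ^t* *m H *m A)
      - (1 / (4 * a ^+ 2) - 1 / (4 * b ^+ 2))%:C
          *: (H *m A ^+ 2 + (A ^t*) ^+ 2 *m H) = 1%:M)
    (B : 'M[R[i]]_n)
    (hB : spectral_norm B <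
      Num.sqrt (spectral_norm A ^+ 2 + b ^+ 2 / spectral_norm H)
        - spectral_norm A)
    (C : 'M[R[i]]_n) :
  exists! X : 'M[R[i]]_n,
    X - (1 / (2 * a ^+ 2) + 1 / (2 * b ^+ 2))%:C
          *: ((A + B) ^t* *m X *m (A + B))
      - (1 / (4 * a ^+ 2) - 1 / (4 * b ^+ 2))%:C
          *: (X *m (A + B) ^+ 2 + (A ^t* + B ^t*) ^+ 2 *m X) = C.
Proof.
have a0 : 0 < a := lt_trans hb hab.
have [q0 p0] : 1 / (4 * a ^+ 2) - 1 / (4 * b ^+ 2) <= 0
    /\ 0 <= 1 / (2 * a ^+ 2) + 1 / (2 * b ^+ 2).
  split; last first.
    apply: addr_ge0; apply: divr_ge0 => //; apply: mulr_ge0 => //; exact: sqr_ge0.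
  rewrite subr_le0 !div1r lef_pV2 ?posrE ?mulr_gt0 ?exprn_gt0 //.
  by rewrite ler_pM2l // ler_pXn2r ?nnegrE ?ltW.
have ABsp : spectrum (A + B) `<=` ellipse_int a b.
  apply: (qlyap_posdef_spectrum a0 hb hH) => x x0.
  apply: lt_le_trans (qlyap_perturb H A B x p0 q0).
  (* Since the operator for A sends H to the identity, the unperturbed form is the squared norm of
     x. *)
  rewrite /re_form /qlyap hHeq mulmx1 -sqr_euclid_norm /= subr_gt0.
  have nx0 := euclid_norm_gt0 x0.
  have al0 := spectral_norm_ge0 A; have be0 := spectral_norm_ge0 B.
  (* In dimension 0 this norm vanishes; the nonzero x at hand makes it positive. *)
  have eta0 : 0 < spectral_norm H.
    have := hH.2 x x0; rewrite -mulmxA => h0.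
    have hpos : 0 < complex.Re ((x ^t* *m (H *m x)) 0 0).
      by rewrite -ltcR RRe_real ?gtr0_real.
    have := spectral_norm_dot H (lexx (euclid_norm x)) (lexx (euclid_norm x)).
    move=> /(lt_le_trans (lt_le_trans hpos (ler_norm _))).
    by rewrite pmulr_lgt0 ?mulr_gt0.
  (* Squaring the bound on B completes the square in |B| + |A|; cancelling |A|^2 leaves this. *)
  have small : spectral_norm H
      * (2 * spectral_norm A * spectral_norm B + spectral_norm B ^+ 2) < b ^+ 2.
    have : (spectral_norm B + spectral_norm A) ^+ 2
        < spectral_norm A ^+ 2 + b ^+ 2 / spectral_norm H.
      apply: sqr_lt_sqrtr; first exact: addr_ge0 be0 al0.
      by move: hB; rewrite ltrBrDr.
    rewrite -ltrBlDl ltr_pdivlMr // mulrC; congr (_ * _ < _).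
    by move: (spectral_norm A) (spectral_norm B) => *; ring.
  rewrite (_ : _ - 2 * _ = (b ^+ 2)^-1); last by field; rewrite !gt_eqF.
  rewrite mulrA gtr_pMl ?exprn_gt0 // mulrC ltr_pdivrMr ?exprn_gt0 //.
  by rewrite mul1r.
have := qlyap_ellipse_bij C a0 hb ABsp.
by rewrite /qlyap linearD /= map_mxD.
Qed.
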